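(* Let $d\ge 1$ be an integer and let $\gamma\in\operatorname{Rat}(4,I_4)$ have degree $2d$. Then $\gamma$ is a product of $d$ quadratic rational curves in $\operatorname{Rat}(4,I_4)$, i.e. there are $\gamma_1,\dots,\gamma_d\in\operatorname{Rat}(4,I_4)$, each of degree $2$, such that $\gamma=\gamma_1\cdots\gamma_d$.
   Context: $\operatorname{SO}_4(\mathbb{R})$ is the group of $X\in\mathbb{R}^{4\times 4}$ with $XX^\top=I_4$ and $\det X=1$. A rational curve on $\operatorname{SO}_4(\mathbb{R})$ is a map $\gamma:\mathbb{R}\to\operatorname{SO}_4(\mathbb{R})$ of the form $\gamma(t)=(p_{ij}(t)/q(t))_{1\le i,j\le 4}$ with $q,p_{ij}\in\mathbb{R}[t]$, where $q$ has no real root, $\gcd(p_{11},p_{12},\dots,p_{44},q)=1$ and $\deg q\ge\deg p_{ij}$ for all $i,j$. Its degree is $\deg(\gamma):=\deg(q)$, which is always an even non-negative integer. The limit $\gamma(\infty):=\lim_{t\to\infty}\gamma(t)$ exists for every rational curve on $\operatorname{SO}_4(\mathbb{R})$. $\operatorname{Rat}(4,I_4)$ denotes the group (under pointwise multiplication) of rational curves $\gamma$ on $\operatorname{SO}_4(\mathbb{R})$ with $\gamma(\infty)=I_4$. A quadratic rational curve is a rational curve on $\operatorname{SO}_4(\mathbb{R})$ of degree $2$. *)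

(* Defs.v *)
From HB Require Import structures.
From mathcomp Require Import all_boot all_order all_algebra.
From mathcomp Require Import boolp classical_sets reals topology normedtype.
Set Implicit Arguments.
Unset Strict Implicit.
Unset Printing Implicit Defensive.
Import Order.TTheory GRing.Theory Num.Theory.
Import numFieldNormedType.Exports.
Local Open Scope classical_set_scope.
Local Open Scope ring_scope.

Definition SO4 (R : realType) : set 'M[R]_4 :=
  [set X | X *m X^T = 1%:M /\ \det X = 1].

(* [gcdp] is only defined up to a nonzero constant, so "the gcd of all p_ij and
   q is 1" is the coprimality of q with a gcd of the p_ij.  As [size 0 = 0],
   [size p <= size q] is deg p <= deg q also when p = 0. *)
Definition represents (R : realType) (p : 'M[{poly R}]_4) (q : {poly R})
    (gamma : R -> 'M[R]_4) : Prop :=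
  [/\ forall t, ~~ root q t,
      coprimep q (\big[@gcdp R/0]_(ij : 'I_4 * 'I_4) p ij.1 ij.2),
      forall i j, (size (p i j) <= size q)%N &
      forall t, gamma t = \matrix_(i, j) ((p i j).[t] / q.[t])].

Definition rational_curve (R : realType) (gamma : R -> 'M[R]_4) : Prop :=
  (forall t, SO4 (gamma t)) /\ exists p q, represents p q gamma.

(* The degree as a relation; [rational_degree_unique] shows that it is
   functional. *)
Definition rational_degree (R : realType) (gamma : R -> 'M[R]_4) (n : nat) :
    Prop :=
  exists p q, represents p q gamma /\ (size q).-1 = n.

(* Since deg p_ij <= deg q, the limits at +oo and at -oo of a rational curve
   exist and coincide. *)
Definition Rat4 (R : realType) (gamma : R -> 'M[R]_4) : Prop :=
  rational_curve gamma /\ gamma t @[t --> +oo] --> (1%:M : 'M[R]_4).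

Lemma represents_dvdp (R : realType) (p p' : 'M[{poly R}]_4) (q q' : {poly R})
    (gamma : R -> 'M[R]_4) :
  represents p q gamma -> represents p' q' gamma -> q %| q'.
Proof.
move=> [q0 cop _ e] [q'0 _ _ e'].
have cross i j : q' * p i j = q * p' i j.
  apply/eqP; rewrite -subr_eq0; apply/eqP.
  set r := (_ - _).
  apply: (@roots_geq_poly_eq0 _ r [seq k%:R | k <- iota 0 (size r)]).
  - apply/allP => _ /mapP[k _ ->].
    have := congr1 (fun M : 'M_4 => M i j) (etrans (esym (e k%:R)) (e' k%:R)).
    rewrite !mxE => /eqP; rewrite eqr_div; [|exact: q0|exact: q'0].
    rewrite /r rootE !hornerE => /eqP h.
    by rewrite mulrC h mulrC subrr.
  - by rewrite map_inj_uniq ?iota_uniq//; apply: mulrIn; rewrite oner_eq0.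
  - by rewrite size_map size_iota.
rewrite -(Gauss_dvdpl _ cop).
have : forall s : seq ('I_4 * 'I_4),
    q %| q' * (\big[@gcdp R/0]_(ij <- s) p ij.1 ij.2).
  elim=> [|ij s IH]; first by rewrite big_nil mulr0 dvdp0.
  rewrite big_cons (eqp_dvdr _ (mulp_gcdr _ _ _)) dvdp_gcd IH andbT.
  by rewrite cross dvdp_mulIl.
by apply.
Qed.

Lemma rational_degree_unique (R : realType) (gamma : R -> 'M[R]_4) (m n : nat) :
  rational_degree gamma m -> rational_degree gamma n -> m = n.
Proof.
move=> [p [q [h <-]]] [p' [q' [h' <-]]]; congr _.-1.
apply: eqp_size; rewrite /eqp.
by rewrite (represents_dvdp h h') (represents_dvdp h' h).
Qed.

(* Main.v *)
Require Import Defs.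
From HB Require Import structures.
From mathcomp Require Import all_boot all_order all_algebra.
From mathcomp Require Import boolp classical_sets reals topology normedtype.
From mathcomp Require Import derive ring lra complex.
Set Implicit Arguments.
Unset Strict Implicit.
Unset Printing Implicit Defensive.
Import Order.TTheory GRing.Theory Num.Theory.
Import numFieldNormedType.Exports.
Local Open Scope classical_set_scope.
Local Open Scope ring_scope.

(** The double cover of SO(4) by pairs of unit quaternions, carried out over
    R(t): a rational curve of degree 2d has the form x |-> A x B^* / q with
    quaternion polynomials A, B such that N(A) N(B) = q^2.  Let M be an
    irreducible quadratic factor of q, so that M^2 divides N(A) N(B).  Whenever
    M divides N(A) but not A, one can split off a linear left factor of norm M
    from A, by looking at the remainder of A modulo M; likewise for B.  Hence
    two such factors can be removed, either one from each of A and B, or two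
    from the same one, and together they form a quadratic curve with
    denominator M.  What is left has denominator q / M, and one concludes by
    induction on d. *)

(** * Quaternions as columns of length four, with their multiplication matrices *)

Local Notation o0 := (@Ordinal 4 0 isT).
Local Notation o1 := (@Ordinal 4 1 isT).
Local Notation o2 := (@Ordinal 4 2 isT).
Local Notation o3 := (@Ordinal 4 3 isT).

Lemma ord4P (P : 'I_4 -> Prop) : P o0 -> P o1 -> P o2 -> P o3 -> forall i, P i.
Proof.
move=> P0 P1 P2 P3 [[|[|[|[|//]]]] Hi].
- by rewrite (_ : Ordinal Hi = o0) //; apply: val_inj.
- by rewrite (_ : Ordinal Hi = o1) //; apply: val_inj.
- by rewrite (_ : Ordinal Hi = o2) //; apply: val_inj.
- by rewrite (_ : Ordinal Hi = o3) //; apply: val_inj.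
Qed.

Lemma sum_ord4 (V : nmodType) (F : 'I_4 -> V) :
  \sum_i F i = F o0 + F o1 + F o2 + F o3.
Proof.
rewrite !big_ord_recr big_ord0 /= add0r.
by congr (F _ + F _ + F _ + F _); apply: val_inj.
Qed.

Definition mx4 (S : nmodType) (rows : seq (seq S)) : 'M[S]_4 :=
  \matrix_(i, j) nth 0 (nth [::] rows i) j.

Section Quaternions.
Variable S : comNzRingType.
Implicit Types (a b u v : 'cV[S]_4) (X : 'M[S]_4).

Definition qnorm a : S := \sum_i a i 0 ^+ 2.

Definition qconj a : 'cV[S]_4 := \col_i (if i == o0 then a i 0 else - a i 0).

Definition qone : 'cV[S]_4 := delta_mx o0 0.

(* [lmulq a] is the matrix of x |-> a x, and [rmulq b] the one of
   x |-> x b^*; the conjugate makes [rmulq] multiplicative as well. *)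
Definition lmulq a : 'M[S]_4 :=
  let: (a0, a1, a2, a3) := (a o0 0, a o1 0, a o2 0, a o3 0) in
  mx4 [:: [:: a0; - a1; - a2; - a3]; [:: a1; a0; - a3; a2];
          [:: a2; a3; a0; - a1]; [:: a3; - a2; a1; a0]].

Definition rmulq b : 'M[S]_4 :=
  let: (b0, b1, b2, b3) := (b o0 0, b o1 0, b o2 0, b o3 0) in
  mx4 [:: [:: b0; b1; b2; b3]; [:: - b1; b0; - b3; b2];
          [:: - b2; b3; b0; - b1]; [:: - b3; - b2; b1; b0]].

(* Four times the coordinates of [X] in the basis [lmulq e_k *m rmulq e_l] of
   the 4x4 matrices, e_k being the quaternion units. *)
Definition euler_mx X : 'M[S]_4 :=
  let x i j := X i j in
  mx4
  [:: [:: x o0 o0 + x o1 o1 + x o2 o2 + x o3 o3;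
          x o0 o1 - x o1 o0 + x o3 o2 - x o2 o3;
          x o0 o2 - x o2 o0 + x o1 o3 - x o3 o1;
          x o0 o3 - x o3 o0 + x o2 o1 - x o1 o2];
      [:: x o1 o0 - x o0 o1 + x o3 o2 - x o2 o3;
          x o0 o0 + x o1 o1 - x o2 o2 - x o3 o3;
          x o1 o2 + x o2 o1 - x o0 o3 - x o3 o0;
          x o1 o3 + x o3 o1 + x o0 o2 + x o2 o0];
      [:: x o2 o0 - x o0 o2 + x o1 o3 - x o3 o1;
          x o1 o2 + x o2 o1 + x o0 o3 + x o3 o0;
          x o0 o0 - x o1 o1 + x o2 o2 - x o3 o3;
          x o2 o3 + x o3 o2 - x o0 o1 - x o1 o0];
      [:: x o3 o0 - x o0 o3 + x o2 o1 - x o1 o2;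
          x o1 o3 + x o3 o1 - x o0 o2 - x o2 o0;
          x o2 o3 + x o3 o2 + x o0 o1 + x o1 o0;
          x o0 o0 - x o1 o1 - x o2 o2 + x o3 o3]].

Lemma mulmx4E m n (A : 'M[S]_(m, 4)) (B : 'M_(4, n)) i j :
  (A *m B) i j =
  A i o0 * B o0 j + A i o1 * B o1 j + A i o2 * B o2 j + A i o3 * B o3 j.
Proof. by rewrite mxE sum_ord4. Qed.

Lemma mx4E rows i j : mx4 rows i j = nth 0 (nth [::] rows i) j :> S.
Proof. by rewrite mxE. Qed.

Ltac entries := apply/matrixP; apply: ord4P; apply: ord4P;
  rewrite ?mulmx4E ?mx4E /= ?mulmx4E ?mx4E /=.

Lemma lmulqM a b : lmulq (lmulq a *m b) = lmulq a *m lmulq b.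
Proof. by entries; ring. Qed.

Lemma rmulqM a b : rmulq (lmulq a *m b) = rmulq a *m rmulq b.
Proof. by entries; ring. Qed.

(** Associativity of the quaternions in matrix form. It later lets right factors move past left
    ones. *)
Lemma lrmulqC a b : lmulq a *m rmulq b = rmulq b *m lmulq a.
Proof. by entries; ring. Qed.

Lemma lmulq_tr a : (lmulq a)^T = lmulq (qconj a).
Proof. by entries; rewrite [LHS]mxE mx4E ?[qconj _ _ _]mxE //= opprK. Qed.

Lemma rmulq_tr a : (rmulq a)^T = rmulq (qconj a).
Proof. by entries; rewrite [LHS]mxE mx4E ?[qconj _ _ _]mxE //= opprK. Qed.

Lemma qnormE a :
  qnorm a = a o0 0 ^+ 2 + a o1 0 ^+ 2 + a o2 0 ^+ 2 + a o3 0 ^+ 2.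
Proof. exact: sum_ord4. Qed.

Lemma qnorm_conj a : qnorm (qconj a) = qnorm a.
Proof. by rewrite !qnormE !mxE /= !sqrrN. Qed.

Lemma lmulqV a : lmulq a *m lmulq (qconj a) = (qnorm a)%:M.
Proof. by rewrite qnormE; entries; rewrite !mxE /= ?mulr1n ?mulr0n; ring. Qed.

Lemma lmulq_one : lmulq qone = 1%:M.
Proof. by entries; rewrite !mxE /= ?oppr0. Qed.

Lemma rmulq_one : rmulq qone = 1%:M.
Proof. by entries; rewrite !mxE /= ?oppr0. Qed.

(** Left multiplication acts only on the index [k] of the basis, hence on the coordinates by the
    same matrix. *)
Lemma euler_mx_lmulq a X : euler_mx (lmulq a *m X) = lmulq a *m euler_mx X.
Proof. by entries; ring. Qed.

(** When the coordinates are products u_k v_l, the expansion of [X] in the basis splits as a product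
    by bilinearity; the 4 is the normalisation of [euler_mx]. *)
Lemma euler_mx_rank1 X u v : euler_mx X = u *m v^T ->
  lmulq u *m rmulq v = X *+ 4.
Proof.
have E i j : (u *m v^T) i j = u i 0 * v j 0 by rewrite mxE big_ord1 !mxE.
move=> h; have {E h} E i j : u i 0 * v j 0 = euler_mx X i j by rewrite h E.
entries; rewrite ?(mulrN, mulNr, E) ?mx4E mulmxnE /=; ring.
Qed.

End Quaternions.

(** * Small determinants, and the rank of the Euler matrix of a rotation *)

(** Entries indexed by natural numbers keep the minors in the same form, so that the expansion can
    be iterated and then computed. *)
Lemma det_natmx (S : comNzRingType) n (f : nat -> nat -> S) :
  \det (\matrix_(i < n.+1, j < n.+1) f i j) =
  \sum_(k < n.+1)
    f 0%N k * ((-1) ^+ k * \det (\matrix_(i < n, j < n) f i.+1 (bump k j))).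
Proof.
rewrite (expand_det_row _ 0); apply: eq_bigr => k _; rewrite mxE /cofactor.
by congr (_ * (_ * \det _)); apply/matrixP => i j; rewrite !mxE.
Qed.

Lemma det_natmx2 (S : comNzRingType) (f : nat -> nat -> S) :
  \det (\matrix_(i < 2, j < 2) f i j) = f 0 0 * f 1 1 - f 0 1 * f 1 0 :> S.
Proof.
rewrite det_natmx !big_ord_recr big_ord0 /= !det_mx11 !mxE /bump /=.
by rewrite expr0 expr1; ring.
Qed.

Lemma det_natmx3 (S : comNzRingType) (f : nat -> nat -> S) :
  \det (\matrix_(i < 3, j < 3) f i j) =
    f 0 0 * (f 1 1 * f 2 2 - f 1 2 * f 2 1)
  - f 0 1 * (f 1 0 * f 2 2 - f 1 2 * f 2 0)
  + f 0 2 * (f 1 0 * f 2 1 - f 1 1 * f 2 0) :> S.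
Proof.
rewrite det_natmx !big_ord_recr big_ord0 /= add0r.
rewrite !(@det_natmx2 _ (fun i j => f i.+1 (bump _ j))) /bump /=.
by ring.
Qed.

Lemma det_natmx4 (S : comNzRingType) (f : nat -> nat -> S) :
  \det (\matrix_(i < 4, j < 4) f i j) =
    f 0 0 * (f 1 1 * (f 2 2 * f 3 3 - f 2 3 * f 3 2)
           - f 1 2 * (f 2 1 * f 3 3 - f 2 3 * f 3 1)
           + f 1 3 * (f 2 1 * f 3 2 - f 2 2 * f 3 1))
  - f 0 1 * (f 1 0 * (f 2 2 * f 3 3 - f 2 3 * f 3 2)
           - f 1 2 * (f 2 0 * f 3 3 - f 2 3 * f 3 0)
           + f 1 3 * (f 2 0 * f 3 2 - f 2 2 * f 3 0))
  + f 0 2 * (f 1 0 * (f 2 1 * f 3 3 - f 2 3 * f 3 1)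
           - f 1 1 * (f 2 0 * f 3 3 - f 2 3 * f 3 0)
           + f 1 3 * (f 2 0 * f 3 1 - f 2 1 * f 3 0))
  - f 0 3 * (f 1 0 * (f 2 1 * f 3 2 - f 2 2 * f 3 1)
           - f 1 1 * (f 2 0 * f 3 2 - f 2 2 * f 3 0)
           + f 1 2 * (f 2 0 * f 3 1 - f 2 1 * f 3 0)) :> S.
Proof.
rewrite det_natmx !big_ord_recr big_ord0 /= add0r.
rewrite !(@det_natmx3 _ (fun i j => f i.+1 (bump _ j))) /bump /=.
ring.
Qed.

Lemma det_lmulq (S : comNzRingType) (a : 'cV[S]_4) :
  \det (lmulq a) = qnorm a ^+ 2.
Proof.
by rewrite qnormE (@det_natmx4 _ (fun i j => nth 0 (nth [::] _ i) j)) /=; ring.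
Qed.

Lemma det_rmulq (S : comNzRingType) (a : 'cV[S]_4) :
  \det (rmulq a) = qnorm a ^+ 2.
Proof.
by rewrite qnormE (@det_natmx4 _ (fun i j => nth 0 (nth [::] _ i) j)) /=; ring.
Qed.

(* The hypotheses say that the 3x3 matrix Z with rows x, y, z satisfies
   Z Z^T = Z^T Z = 1 and Z = cofactor matrix of Z; the 2x2 minors of the Euler
   matrix of the rotation Z are linear combinations of these relations. *)
Lemma rotation_euler_minors (R : realFieldType)
    (x1 x2 x3 y1 y2 y3 z1 z2 z3 : R) :
  x1^+2 + x2^+2 + x3^+2 = 1 ->
  y1^+2 + y2^+2 + y3^+2 = 1 ->
  z1^+2 + z2^+2 + z3^+2 = 1 ->
  x1^+2 + y1^+2 + z1^+2 = 1 ->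
  x2^+2 + y2^+2 + z2^+2 = 1 ->
  x3^+2 + y3^+2 + z3^+2 = 1 ->
  x1 * y1 + x2 * y2 + x3 * y3 = 0 ->
  x1 * z1 + x2 * z2 + x3 * z3 = 0 ->
  z1 * y1 + z2 * y2 + z3 * y3 = 0 ->
  x1 * x2 + y1 * y2 + z1 * z2 = 0 ->
  x1 * x3 + y1 * y3 + z1 * z3 = 0 ->
  x2 * x3 + y2 * y3 + z2 * z3 = 0 ->
  x1 = y2 * z3 - y3 * z2 ->
  x2 = y3 * z1 - y1 * z3 ->
  x3 = y1 * z2 - y2 * z1 ->
  y1 = z2 * x3 - z3 * x2 ->
  y2 = z3 * x1 - z1 * x3 ->
  y3 = z1 * x2 - z2 * x1 ->
  z1 = x2 * y3 - x3 * y2 ->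
  z2 = x3 * y1 - x1 * y3 ->
  z3 = x1 * y2 - x2 * y1 ->
  let c := fun i j => nth 0 (nth [::]
   [:: [:: 1 + x1 + y2 + z3; z2 - y3; x3 - z1; y1 - x2];
       [:: z2 - y3; 1 + x1 - y2 - z3; x2 + y1; x3 + z1];
       [:: x3 - z1; x2 + y1; 1 - x1 + y2 - z3; y3 + z2];
       [:: y1 - x2; x3 + z1; y3 + z2; 1 - x1 - y2 + z3] ] i) j in
  forall i j k l : 'I_4, c i j * c k l = c i l * c k j.
Proof.
do 21 (let h := fresh in move=> h).
move=> c.
do 4 apply: ord4P; rewrite /c /=; try ring.
all: lra.
Qed.

(** After expanding both products into double sums, the relation for [B] applies term by term. *)
Lemma minors_mulmx (S : comNzRingType) m n p
    (A : 'M[S]_(m, n)) (B : 'M[S]_(n, p)) :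
  (forall i j k l, B i j * B k l = B i l * B k j) ->
  forall i j k l, (A *m B) i j * (A *m B) k l = (A *m B) i l * (A *m B) k j.
Proof.
move=> h i j k l; rewrite !mxE !big_distrlr /=.
by do 2 apply: eq_bigr => ? _; rewrite mulrACA h mulrACA.
Qed.

(* Left multiplication by the conjugate of the image of 1 reduces to the case
   where [X] fixes 1, that is, to a rotation of 3-space. *)
Lemma euler_mx_minors (R : realFieldType) (X : 'M[R]_4) :
  X *m X^T = 1%:M -> \det X = 1 ->
  forall i j k l,
    euler_mx X i j * euler_mx X k l = euler_mx X i l * euler_mx X k j.
Proof.
move=> XXt detX.
have XtX : X^T *m X = 1%:M by apply: mulmx1C.
pose a : 'cV[R]_4 := col o0 X.
have na : qnorm a = 1.
  have := congr1 (fun M : 'M_4 => M o0 o0) XtX.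
  rewrite mulmx4E ![_^T _ _]mxE [RHS]mxE /= qnormE /a !mxE => h.
  by rewrite !expr2.
pose Y := lmulq (qconj a) *m X.
have laV : lmulq a *m lmulq (qconj a) = 1%:M by rewrite lmulqV na.
have XE : X = lmulq a *m Y by rewrite mulmxA laV mul1mx.
have detY : \det Y = 1.
  by rewrite det_mulmx det_lmulq qnorm_conj na detX expr1n mulr1.
have YYt : Y *m Y^T = 1%:M.
  rewrite trmx_mul mulmxA -(mulmxA _ X) XXt mulmx1 -lmulq_tr trmxK.
  by rewrite lmulq_tr mulmx1C.
have YtY : Y^T *m Y = 1%:M by apply: mulmx1C.
(* [X] and [lmulq a] have the same first column [a], so [Y] has the first column of the identity. *)
have Y0 i : Y i o0 = (i == o0)%:R.
  have -> : Y i o0 = (lmulq (qconj a) *m lmulq a) i o0.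
    rewrite !mulmx4E; move: i; apply: ord4P; rewrite !mx4E /= !mxE /=; ring.
  by rewrite (mulmx1C laV) mxE.
(* Orthogonality of column 0 to the others now forces the first row as well. *)
have Yr j : Y o0 j = (o0 == j)%:R.
  have := congr1 (fun M : 'M_4 => M o0 j) YtY.
  by rewrite mulmx4E ![_^T _ _]mxE !Y0 /= [RHS]mxE !mul0r !addr0 mul1r.
rewrite XE {XXt XtX na laV detX XE}; clearbody Y.
(* As [Y] is orthogonal of determinant 1, it equals its own cofactor matrix. *)
have adjY : \adj Y = Y^T.
  by rewrite -[LHS]mulmx1 -YYt mulmxA mul_adj_mx detY mul1mx.
have cof i j : Y i j = cofactor Y i j.
  by have := congr1 (fun M : 'M_4 => M j i) adjY; rewrite !mxE.
have cofE i j : Y i j = (-1) ^+ (i + j) *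
   \det (\matrix_(k < 3, l < 3) Y (inord (bump i k)) (inord (bump j l))).
  rewrite {1}cof /cofactor; congr (_ * \det _); apply/matrixP => k l.
  rewrite !mxE.
  congr (Y _ _); apply: val_inj; rewrite /= inordK //;
    exact: (ltn_ord (lift _ _)).
have row i j : \sum_k Y i k * Y j k = (i == j)%:R.
  have := congr1 (fun M : 'M_4 => M i j) YYt; rewrite !mxE => <-.
  by apply: eq_bigr => k _; rewrite mxE.
have col i j : \sum_k Y k i * Y k j = (i == j)%:R.
  have := congr1 (fun M : 'M_4 => M i j) YtY; rewrite !mxE => <-.
  by apply: eq_bigr => k _; rewrite mxE.
have /= r11 := row o1 o1; have /= r22 := row o2 o2; have /= r33 := row o3 o3.
have /= r12 := row o1 o2; have /= r13 := row o1 o3; have /= r23 := row o3 o2.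
have /= c11 := col o1 o1; have /= c22 := col o2 o2; have /= c33 := col o3 o3.
have /= c12 := col o1 o2; have /= c13 := col o1 o3; have /= c23 := col o2 o3.
have oE : (inord 0 = o0) * (inord 1 = o1) * (inord 2 = o2) * (inord 3 = o3).
  by do !split; apply: val_inj; rewrite /= inordK.
have /= h11 := cofE o1 o1; have /= h12 := cofE o1 o2; have /= h13 := cofE o1 o3.
have /= h21 := cofE o2 o1; have /= h22 := cofE o2 o2; have /= h23 := cofE o2 o3.
have /= h31 := cofE o3 o1; have /= h32 := cofE o3 o2; have /= h33 := cofE o3 o3.
move: r11 r22 r33 r12 r13 r23 c11 c22 c33 c12 c13 c23.
rewrite !sum_ord4 !Y0 !Yr /= !mul0r !add0r -!expr2.
move=> r11 r22 r33 r12 r13 r23 c11 c22 c33 c12 c13 c23.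
move: h11 h12 h13 h21 h22 h23 h31 h32 h33.
rewrite !(@det_natmx3 _
  (fun k l => Y (inord (bump _ k)) (inord (bump _ l)))) /bump /=.
rewrite !add0n !oE !Y0 !Yr /=.
move=> h11 h12 h13 h21 h22 h23 h31 h32 h33.
have minors : forall i j k l,
   euler_mx Y i j * euler_mx Y k l = euler_mx Y i l * euler_mx Y k j.
  have := @rotation_euler_minors R _ _ _ _ _ _ _ _ _
    r11 r22 r33 c11 c22 c33 r12 r13 r23 c12 c13 c23.
  move=> minors i j k l; rewrite !mx4E !Y0 !Yr /= !subr0 ?add0r ?addr0.
  apply: minors.
  - rewrite {1}h11; ring.
  - rewrite {1}h12; ring.
  - rewrite {1}h13; ring.
  - rewrite {1}h21; ring.
  - rewrite {1}h22; ring.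
  - rewrite {1}h23; ring.
  - rewrite {1}h31; ring.
  - rewrite {1}h32; ring.
  - rewrite {1}h33; ring.
by rewrite euler_mx_lmulq; apply: minors_mulmx.
Qed.

(** * The multiplicative norm, and compatibility with ring morphisms *)

Section QuaternionAlgebra.
Variable S : comNzRingType.
Implicit Types a b : 'cV[S]_4.

Lemma qnormM a b : qnorm (lmulq a *m b) = qnorm a * qnorm b.
Proof. by rewrite !qnormE !mulmx4E !mx4E /=; ring. Qed.

Lemma lmulq1 a : lmulq a *m qone S = a.
Proof.
apply/colP; apply: ord4P; rewrite mulmx4E !mx4E /= ![qone _ _ _]mxE /=; ring.
Qed.

Lemma lmul_conjq a : lmulq (qconj a) *m a = qnorm a *: qone S.
Proof.
apply/colP; apply: ord4P;
  rewrite mulmx4E !mx4E [RHS]mxE qnormE /= !mxE /=; ring.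
Qed.

Lemma lmulqD a b : lmulq (a + b) = lmulq a + lmulq b.
Proof.
apply/matrixP; apply: ord4P; apply: ord4P;
  rewrite [RHS]mxE !mx4E /= !mxE //; ring.
Qed.

Lemma lmulqZ (c : S) a : lmulq (c *: a) = c *: lmulq a.
Proof.
apply/matrixP; apply: ord4P; apply: ord4P;
  rewrite [RHS]mxE !mx4E /= !mxE //; ring.
Qed.

Lemma rmulqD a b : rmulq (a + b) = rmulq a + rmulq b.
Proof.
apply/matrixP; apply: ord4P; apply: ord4P;
  rewrite [RHS]mxE !mx4E /= !mxE //; ring.
Qed.

Lemma rmulqZ (c : S) a : rmulq (c *: a) = c *: rmulq a.
Proof.
apply/matrixP; apply: ord4P; apply: ord4P;
  rewrite [RHS]mxE !mx4E /= !mxE //; ring.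
Qed.

Lemma qnormDZ (c : S) a b :
  qnorm (c *: a + b) =
  c ^+ 2 * qnorm a + c * (\sum_i a i 0 * b i 0) *+ 2 + qnorm b.
Proof. by rewrite !qnormE sum_ord4 !mxE; ring. Qed.

(** Transposition is conjugation, so each factor contributes its norm. Applied to A and B, this
    links N(A) N(B) to the denominator of the curve. *)
Lemma lrmulq_tr a b :
  (lmulq a *m rmulq b)^T *m (lmulq a *m rmulq b) = (qnorm a * qnorm b)%:M.
Proof.
rewrite trmx_mul mulmxA -(mulmxA (rmulq b)^T) lmulq_tr -lmulqM lmul_conjq.
rewrite lmulqZ lmulq_one scalemx1 mul_mx_scalar -scalemxAl rmulq_tr -rmulqM.
by rewrite lmul_conjq rmulqZ rmulq_one scalemx1 scale_scalar_mx.
Qed.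

End QuaternionAlgebra.

Lemma map_lmulq (S T : comNzRingType) (f : {rmorphism S -> T}) (a : 'cV[S]_4) :
  map_mx f (lmulq a) = lmulq (map_mx f a).
Proof.
by apply/matrixP; apply: ord4P; apply: ord4P;
  rewrite [LHS]mxE !mx4E /= !mxE ?rmorphN.
Qed.

Lemma map_rmulq (S T : comNzRingType) (f : {rmorphism S -> T}) (a : 'cV[S]_4) :
  map_mx f (rmulq a) = rmulq (map_mx f a).
Proof.
by apply/matrixP; apply: ord4P; apply: ord4P;
  rewrite [LHS]mxE !mx4E /= !mxE ?rmorphN.
Qed.

Lemma map_qnorm (S T : comNzRingType) (f : {rmorphism S -> T}) (a : 'cV[S]_4) :
  qnorm (map_mx f a) = f (qnorm a).
Proof. by rewrite rmorph_sum; apply: eq_bigr => i _; rewrite mxE rmorphXn. Qed.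

Lemma map_euler_mx (S T : comNzRingType) (f : {rmorphism S -> T})
    (X : 'M[S]_4) :
  map_mx f (euler_mx X) = euler_mx (map_mx f X).
Proof.
by apply/matrixP; apply: ord4P; apply: ord4P;
  rewrite [LHS]mxE !mx4E /= !mxE ?(rmorphD, rmorphN).
Qed.

Lemma qnorm_eq0 (R : realDomainType) (a : 'cV[R]_4) : (qnorm a == 0) = (a == 0).
Proof.
rewrite psumr_eq0; last by move=> i _; apply: sqr_ge0.
apply/allP/eqP => [h|-> i _]; last by rewrite mxE expr0n /=.
apply/colP => i; rewrite mxE; apply/eqP; rewrite -sqrf_eq0.
by have := h i (mem_index_enum i).
Qed.

(** * Rank-one matrices over the polynomial ring *)

Lemma bezout_family (F : fieldType) n (f : nat -> {poly F}) :
  exists g (v w : nat -> {poly F}),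
    \sum_(i < n) w i * f i = g /\ forall i, (i < n)%N -> f i = v i * g.
Proof.
elim: n f => [|n IH] f; first by exists 0, f, f; rewrite big_ord0.
have [g' [v' [w' [sw' fE']]]] := IH (fun i => f i.+1).
have [[u1 u2] /= ug] := Bezoutp (f 0%N) g'.
set g := u1 * _ + _ in ug.
have /divpK f0 : g %| f 0%N by rewrite (eqp_dvdl _ ug) dvdp_gcdl.
have /divpK g0 : g %| g' by rewrite (eqp_dvdl _ ug) dvdp_gcdr.
exists g, (fun i => if i is k.+1 then v' k * (g' %/ g) else f 0%N %/ g),
  (fun i => if i is k.+1 then u2 * w' k else u1); split.
  rewrite big_ord_recl /= /g -sw' mulr_sumr; congr (_ + _).
  by apply: eq_bigr => i _; rewrite mulrA.
by case=> [|i] hi //; rewrite fE' // -mulrA g0.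
Qed.

(* Dividing a nonzero row by its gcd leaves a unimodular row [v]; a Bezout
   relation for [v] then exhibits the other factor without denominators. *)
Lemma rank1_poly_mx (F : fieldType) m n (C : 'M[{poly F}]_(m, n)) :
  (forall i j k l, C i j * C k l = C i l * C k j) ->
  exists (u : 'cV[{poly F}]_m) (v : 'cV[{poly F}]_n), C = u *m v^T.
Proof.
move=> minors; have [->|/eqP/matrix0Pn[i0 [j0 Cij0]]] := pselect (C = 0).
  by exists 0, 0; rewrite mul0mx.
(* Row [i0], extended by zero to all natural indices so that [bezout_family] applies. *)
pose f k := if insub k is Some j then C i0 j else 0.
have fE (j : 'I_n) : f j = C i0 j by rewrite /f valK.
have [g [v [w [gE fE']]]] := bezout_family n f.
have g0 : g != 0 by apply: contraNneq Cij0 => g0; rewrite -fE fE' ?g0 ?mulr0.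
have w1 : \sum_(i < n) w i * v i = 1.
  apply: (mulIf g0); rewrite mul1r -[RHS]gE mulr_suml.
  by apply: eq_bigr => i _; rewrite (fE' i) ?mulrA.
exists (\col_i \sum_(l < n) w l * C i l), (\col_j v j).
apply/matrixP => i j; rewrite mxE big_ord1 !mxE.
rewrite -[LHS]mulr1 -w1 mulr_sumr mulr_suml; apply: eq_bigr => l _.
have : C i j * v l = C i l * v j.
  by apply: (mulIf g0); rewrite -!mulrA -!fE' // !fE minors.
by move=> h; rewrite mulrCA h mulrA.
Qed.

(** The rank-one factors of the Euler matrix are polynomial, so no denominators arise; the factor
    1/4 undoes the normalisation of [euler_mx]. *)
Lemma spin_factor (R : realFieldType) (P : 'M[{poly R}]_4) :
  (forall i j k l,
    euler_mx P i j * euler_mx P k l = euler_mx P i l * euler_mx P k j) ->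
  exists A B : 'cV[{poly R}]_4, P = lmulq A *m rmulq B.
Proof.
move=> /rank1_poly_mx[u [v /euler_mx_rank1 uv]].
exists ((4%:R^-1)%:P *: u), v; rewrite lmulqZ -scalemxAl uv.
rewrite -(@scaler_nat {poly R}) scalerA -polyC_natr -polyCM mulVf ?pnatr_eq0 //.
by rewrite scale1r.
Qed.

(** * Linear left factors of quaternion polynomials *)

Lemma horner_eq0_poly0 (R : numDomainType) (p : {poly R}) :
  (forall t, p.[t] = 0) -> p = 0.
Proof.
move=> p0; apply: (@roots_geq_poly_eq0 _ p [seq k%:R | k <- iota 0 (size p)]).
- by apply/allP => x _; rewrite rootE p0.
- by rewrite map_inj_uniq ?iota_uniq//; apply: mulrIn; rewrite oner_eq0.
- by rewrite size_map size_iota.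
Qed.

Lemma poly_size2 (R : nzRingType) (p : {poly R}) : (size p <= 2)%N ->
  p = p`_1 *: 'X + (p`_0)%:P.
Proof.
move=> sp; apply/polyP => -[|[|i]];
  rewrite coefD coefZ coefX coefC /= ?mulr1 ?mulr0 ?addr0 ?add0r //.
by rewrite nth_default // (leq_trans sp).
Qed.

(* The remainder of [A] modulo [M] is linear, and its leading coefficient is
   invertible because [M] does not divide [A]; normalising it gives [L]. *)
Lemma quaternion_linear_factor (R : realFieldType) (M : {poly R})
    (A : 'cV[{poly R}]_4) :
  size M = 3%N -> M \is monic -> M %| qnorm A ->
  ~ (forall i, M %| A i 0) ->
  exists (h : 'cV[R]_4) (A' : 'cV[{poly R}]_4),
    let L := 'X *: qone _ + map_mx polyC h in
    qnorm L = M /\ A = lmulq L *m A'.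
Proof.
move=> sM Mmon MNA MA.
pose Q := map_mx (fun p => p %/ M) A; pose r := map_mx (fun p => p %% M) A.
have AE : A = M *: Q + r.
  by apply/colP => i; rewrite !mxE mulrC -divp_eq.
pose r1 := map_mx (fun p : {poly R} => p`_1) r.
pose r0 := map_mx (fun p : {poly R} => p`_0) r.
have rE : r = 'X *: map_mx polyC r1 + map_mx polyC r0.
  apply/colP => i; rewrite !mxE [LHS]poly_size2.
    by rewrite -mul_polyC mulrC.
  by have := ltn_modp (A i 0) M; rewrite -size_poly_eq0 sM.
have r_neq0 : r != 0.
  apply/eqP => r00; apply: MA => i; move/colP: r00 => /(_ i); rewrite !mxE.
  by move/eqP; rewrite /dvdp.
(* N(A) and N(r) agree modulo [M]. *)
have {MNA} [k Nr] : exists k, qnorm r = k * M.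
  apply/dvdpP; move: MNA; rewrite AE qnormDZ dvdp_addr // -mulrnAr.
  by rewrite dvdp_add // ?dvdp_mulr // expr2 dvdp_mulr.
have NrE : qnorm r = (qnorm r1) *: 'X^2 +
    ((\sum_i r1 i 0 * r0 i 0) *+ 2) *: 'X + (qnorm r0)%:P.
  rewrite rE qnormDZ !map_qnorm -!mul_polyC -mulrnAr mulrC; congr (_ + _ + _).
  rewrite mulrC; congr (_ * _); rewrite polyCMn; congr (_ *+ 2).
  by rewrite rmorph_sum; apply: eq_bigr => j _; rewrite !mxE /= polyCM.
(* N(r) has degree at most 2 and [M] is a monic quadratic, so [k] is the coefficient of X^2 in
   N(r). *)
have kE : k = (qnorm r1)%:P.
  have sk : (size k <= 1)%N.
    have [->|k0] := eqVneq k 0; first by rewrite size_poly0.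
    have : (size (qnorm r) <= 3)%N.
      rewrite NrE; apply/leq_sizeP => -[|[|[|i]]] // _.
      by rewrite !(coefD, coefZ, coefXn, coefX, coefC) /= !mulr0 !addr0.
    by rewrite Nr size_Mmonic // sM addnC /= !ltnS.
  rewrite (size1_polyC sk) in Nr *; congr _%:P.
  have := congr1 (fun p : {poly R} => p`_2) Nr.
  rewrite NrE !(coefD, coefZ, coefXn, coefX, coefC) /= coefCM.
  rewrite mulr1 mulr0 !addr0.
  by move/monicP: Mmon; rewrite /lead_coef sM /= => ->; rewrite mulr1.
(* The norm is positive definite: N(r1) = 0 gives r1 = 0, then N(r) = 0 gives r0 = 0, contradicting
   r != 0. *)
have c0 : qnorm r1 != 0.
  apply: contraNneq r_neq0 => c0; move: (NrE).
  rewrite Nr kE c0 mul0r scale0r add0r.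
  have /eqP := c0; rewrite qnorm_eq0 => /eqP r10.
  rewrite r10 big1 ?mul0rn ?scale0r ?add0r => [|i _]; last by rewrite mxE mul0r.
  move/esym/eqP; rewrite polyC_eq0 qnorm_eq0 => /eqP r00.
  by rewrite rE r10 r00 !map_mx0 scaler0 addr0.
set c := qnorm r1 in c0 kE.
(* This is r0 times the inverse of r1, so that L r1 = r. *)
pose h := c^-1 *: (lmulq r0 *m qconj r1).
pose L := 'X *: qone _ + map_mx polyC h : 'cV[{poly R}]_4.
have Lr1 : lmulq L *m map_mx polyC r1 = r.
  rewrite rE lmulqD mulmxDl lmulqZ -scalemxAl lmulq_one mul1mx; congr (_ + _).
  rewrite -map_lmulq -map_mxM; congr map_mx.
  rewrite lmulqZ -scalemxAl lmulqM -mulmxA lmul_conjq -scalemxAr lmulq1.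
  by rewrite scalerA mulVf // scale1r.
have NL : qnorm L = M.
  have : k != 0 by rewrite kE polyC_eq0.
  by move/mulIf; apply; rewrite [RHS]mulrC -Nr -Lr1 qnormM map_qnorm kE.
(* Since L times its conjugate is M, L times this witness is M Q + r = A. *)
exists h, (lmulq (qconj L) *m Q + map_mx polyC r1); split=> //.
by rewrite mulmxDr Lr1 mulmxA lmulqV NL mul_scalar_mx -AE.
Qed.

(** * Irreducible quadratic factors of real polynomials without real roots *)

Local Notation cpoly := (map_poly (real_complex _)).

(** A complex root a + ib of [q] has b != 0. Take M = (X - a)^2 + b^2: the remainder of [q] modulo
    [M] is real of degree at most 1 and vanishes at a + ib, hence is zero. *)
Lemma monic_quadratic_factor (R : realType) (q : {poly R}) :
  (1 < size q)%N -> (forall x, ~~ root q x) ->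
  exists M : {poly R},
    [/\ M \is monic, size M = 3%N, irreducible_poly M & (M %| q)%R].
Proof.
move=> sq q0.
have [z /rootP qz] : exists z : R[i], root (cpoly q) z.
  by apply/closed_rootP; rewrite size_map_poly; case: (size q) sq => [|[]].
case: z qz => a b qz.
pose M : {poly R} := 'X^2 - (a *+ 2) *: 'X + (a ^+ 2 + b ^+ 2)%:P.
have sM' : (size (- ((a *+ 2) *: 'X) + (a ^+ 2 + b ^+ 2)%:P)%R <
    size ('X^2 : {poly R}))%N.
  rewrite size_polyXn ltnS (leq_trans (size_polyD _ _)) // geq_max size_polyN.
  rewrite (leq_trans (size_scale_leq _ _)) ?size_polyX //.
  by rewrite (leq_trans (size_polyC_leq1 _)).
have sM : size M = 3%N by rewrite /M -addrA size_polyDl // size_polyXn.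
have Mmon : M \is monic.
  by rewrite monicE /M -addrA lead_coefDl // lead_coefXn.
have Mz : (cpoly M).[(a +i* b)%C] = 0.
  rewrite !(rmorphD, rmorphN) /= map_polyXn map_polyZ map_polyX !map_polyC /=.
  rewrite !hornerE /= expr2; simpc; apply/eqP; rewrite eq_complex /=.
  by apply/andP; split; apply/eqP; ring.
have qM : (M %| q)%R.
  have sr : (size (q %% M)%R <= 2)%N.
    have := ltn_modp q M; rewrite -size_poly_eq0 sM //.
  have rz : (cpoly (q %% M)).[(a +i* b)%C] = 0.
    have := qz; rewrite {1}(divp_eq q M) rmorphD rmorphM hornerD hornerM /= Mz.
    by rewrite mulr0 add0r.
  have b0 : b != 0.
    apply: contraTneq sq => b0; move: qz.
    rewrite b0 -[(a +i* 0)%C]/(real_complex _ a).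
    rewrite horner_map => /eqP; rewrite fmorph_eq0 => qa.
    by have := q0 a; rewrite rootE qa.
  move: rz; rewrite [q %% M]poly_size2 // rmorphD /=.
  rewrite map_polyZ map_polyX map_polyC /= !hornerE; simpc => /eqP.
  rewrite eq_complex /= => /andP[/eqP re /eqP im].
  have r1 : (q %% M)`_1 = 0.
    by apply/eqP; move/eqP: im; rewrite mulf_eq0 (negPf b0) orbF.
  have r0 : (q %% M)`_0 = 0 by move: re; rewrite r1 mul0r add0r.
  by rewrite /dvdp [q %% M]poly_size2 // r1 r0 scale0r add0r.
exists M; split=> //; apply: cubic_irreducible; rewrite ?sM // => x.
by apply: contraNN (q0 x) ; rewrite -!dvdp_XsubCl => /dvdp_trans; apply.
Qed.

(** * Limits at infinity, read off from coefficients *)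

(** The quotient is the reversed polynomial evaluated at 1/t, which tends to its constant
    coefficient. *)
Lemma horner_div_cvg (R : realType) n (p : {poly R}) : (size p <= n.+1)%N ->
  p.[t] / t ^+ n @[t --> +oo] --> p`_n.
Proof.
move=> sp; pose r := \poly_(i < n.+1) p`_(n - i).
have -> : p`_n = r.[0] by rewrite horner_coef0 coef_poly /= subn0.
have Vt : t^-1 @[t --> +oo] --> (0 : R).
  by apply/gtr0_cvgV0; [exact: nbhs_pinfty_gt|exact: cvg_id].
apply: cvg_trans (cvg_comp _ _ Vt (@continuous_horner _ r 0)).
apply: near_eq_cvg; near=> t.
have t0 : t != 0 by rewrite gt_eqF //; near: t; exact: nbhs_pinfty_gt.
rewrite /= (horner_coef_wide _ sp) mulr_suml horner_poly.
rewrite [RHS](reindex_inj rev_ord_inj) /=; apply: eq_bigr => i _.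
have hi : (i <= n)%N by rewrite -ltnS.
rewrite subSS -mulrA; congr (_ * _).
rewrite -[in t ^+ n](subnK hi) exprD exprVn; field; rewrite !expf_neq0 //.
Unshelve. all: by end_near. Qed.

Lemma cvg_mx_coordP (R : realType) m n T (F : set_system T) {FF : Filter F}
    (f : T -> 'M[R]_(m, n)) (l : 'M[R]_(m, n)) :
  f @ F --> l <-> forall i j, f x i j @[x --> F] --> l i j.
Proof.
split=> [fl i j|fl].
  apply: (@continuous_cvg _ _ _ F _ f (fun M : 'M_(m, n) => M i j)) fl.
  exact: coord_continuous.
move=> A [P nP PA]; rewrite nbhs_filterE.
have : \forall x \near F, forall i j, P i j (f x i j).
  by do 2 apply: filter_forall => ?; apply: fl.
by apply: filterS => x Px; apply: PA.
Qed.

Lemma ratio_cvg (R : realType) (p q : {poly R}) :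
  q != 0 -> (size p <= size q)%N ->
  p.[t] / q.[t] @[t --> +oo] --> p`_(size q).-1 / lead_coef q.
Proof.
move=> q0 pq; pose n := (size q).-1.
have sq : size q = n.+1 by rewrite prednK // size_poly_gt0.
have cp : p.[t] / t ^+ n @[t --> +oo] --> p`_n.
  by apply: horner_div_cvg; rewrite -sq.
have cq : q.[t] / t ^+ n @[t --> +oo] --> lead_coef q.
  by apply: horner_div_cvg; rewrite sq.
have lq0 : lead_coef q != 0 by rewrite lead_coef_eq0.
apply: cvg_trans (cvgM cp (cvgV lq0 cq)).
apply: near_eq_cvg; near=> t.
have t0 : t != 0 by rewrite gt_eqF //; near: t; exact: nbhs_pinfty_gt.
by rewrite /= invf_div mulrA divfK // expf_neq0.
Unshelve. all: by end_near. Qed.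

(** The algebraic form of having limit I at infinity, suited to the induction. *)
Definition identity_at_infinity (R : realType) (p : 'M[{poly R}]_4)
    (q : {poly R}) :=
  forall i j, (p i j)`_(size q).-1 = (i == j)%:R * lead_coef q.

Lemma represents_cvg1P (R : realType) p q (gamma : R -> 'M[R]_4) :
  represents p q gamma ->
  gamma t @[t --> +oo] --> (1%:M : 'M[R]_4) <-> identity_at_infinity p q.
Proof.
move=> [q0 _ spq gE].
have qn0 : q != 0 by apply: contraNneq (q0 0) => ->; rewrite root0.
have lq0 : lead_coef q != 0 by rewrite lead_coef_eq0.
have cv i j : gamma t i j @[t --> +oo] --> (p i j)`_(size q).-1 / lead_coef q.
  under eq_fun do rewrite gE mxE.
  exact: ratio_cvg.
rewrite cvg_mx_coordP; split=> h i j.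
  have := h i j; rewrite mxE => hij.
  have := cvg_unique _ (cv i j) hij => /(_ (@norm_hausdorff _ _)) <-.
  by rewrite divfK.
by have := cv i j; rewrite h mulfK // mxE.
Qed.

(** * Divisibility and top coefficients *)

Lemma irreducible_coprimep (F : fieldType) (M p : {poly F}) :
  irreducible_poly M -> ~~ (M %| p) -> coprimep M p.
Proof.
move=> [_ irrM]; apply: contraNT => cop.
by rewrite -(eqp_dvdl _ (irrM _ cop (dvdp_gcdl M p))) dvdp_gcdr.
Qed.

Lemma dvdp_biggcd (F : fieldType) (I : finType) (p : I -> {poly F}) r :
  reflect (forall i, r %| p i) (r %| \big[@gcdp F/0]_i p i).
Proof.
have seqE (s : seq I) :
    (r %| \big[@gcdp F/0]_(i <- s) p i) = all (fun i => r %| p i) s.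
  elim: s => [|i s IH]; first by rewrite big_nil dvdp0.
  by rewrite big_cons dvdp_gcd IH.
rewrite seqE; apply: (iffP allP) => h i; last by move=> _; apply: h.
exact: h (mem_index_enum i).
Qed.

(** [m] and [n] only bound the degrees, so entries with vanishing top coefficient are covered. *)
Lemma coefM_top (S : nzSemiRingType) (p q : {poly S}) m n :
  (size p <= m.+1)%N -> (size q <= n.+1)%N -> (p * q)`_(m + n) = p`_m * q`_n.
Proof.
move=> sp sq; rewrite coefM.
have hm : (m < (m + n).+1)%N by rewrite ltnS leq_addr.
rewrite (bigD1 (Ordinal hm)) //= addKn big1 ?addr0 // => i im.
have [lim|leim] := ltnP i m.
  rewrite [q`__]nth_default ?mulr0 //; apply: leq_trans sq _.
  by rewrite ltn_subRL ltn_add2r.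
rewrite nth_default ?mul0r //; apply: leq_trans sp _.
by rewrite ltn_neqAle leim andbT eq_sym.
Qed.

Lemma dvdp_mulmxl (F : fieldType) m n p (M : {poly F})
    (A : 'M_(m, n)) (B : 'M_(n, p)) :
  (forall i j, M %| A i j) -> forall i j, M %| (A *m B) i j.
Proof.
move=> MA i j; rewrite mxE; apply: (big_ind (fun x => M %| x)) => [|x y|k _].
- exact: dvdp0.
- exact: dvdp_add.
by rewrite dvdp_mulr.
Qed.

Lemma dvdp_mulmxr (F : fieldType) m n p (M : {poly F})
    (A : 'M_(m, n)) (B : 'M_(n, p)) :
  (forall i j, M %| B i j) -> forall i j, M %| (A *m B) i j.
Proof.
move=> MB i j; rewrite mxE; apply: (big_ind (fun x => M %| x)) => [|x y|k _].
- exact: dvdp0.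
- exact: dvdp_add.
by rewrite dvdp_mull.
Qed.

Lemma dvdp_lmulq (F : fieldType) (M : {poly F}) (A : 'cV_4) :
  (forall i, M %| A i 0) -> forall i j, M %| lmulq A i j.
Proof. by move=> MA; apply: ord4P; apply: ord4P; rewrite mx4E /= ?dvdpNr. Qed.

Lemma dvdp_rmulq (F : fieldType) (M : {poly F}) (A : 'cV_4) :
  (forall i, M %| A i 0) -> forall i j, M %| rmulq A i j.
Proof. by move=> MA; apply: ord4P; apply: ord4P; rewrite mx4E /= ?dvdpNr. Qed.

(** * Splitting rotors off a pair of quaternion polynomials *)

(** Common shape of [lmulq L] and [rmulq L] for L = X + h of norm M, so that factors from either
    side are treated alike. *)
Definition linear_rotor (R : realType) (M : {poly R}) (K : 'M[{poly R}]_4) :=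
  [/\ exists H : 'M[R]_4, K = 'X%:M + map_mx polyC H,
      K^T *m K = M%:M & \det K = M ^+ 2].

Section LinearFactors.
Variables (R : realType) (M : {poly R}).
Hypotheses (Mmon : M \is monic) (sM : size M = 3%N) (Mirr : irreducible_poly M).
Implicit Types A B : 'cV[{poly R}]_4.

Lemma quaternion_rotor_factor A : M %| qnorm A -> ~ (forall i, M %| A i 0) ->
  exists L A', [/\ linear_rotor M (lmulq L), linear_rotor M (rmulq L),
    qnorm L = M & A = lmulq L *m A'].
Proof.
move=> MA nMA; have [h [A' [NL AE]]] := quaternion_linear_factor sM Mmon MA nMA.
exists ('X *: qone _ + map_mx polyC h), A'; split=> //; split.
- exists (lmulq h); rewrite lmulqD lmulqZ lmulq_one map_lmulq.
  by rewrite scalemx1.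
- by rewrite lmulq_tr -lmulqM lmul_conjq NL lmulqZ lmulq_one scalemx1.
- by rewrite det_lmulq NL.
- exists (rmulq h); rewrite rmulqD rmulqZ rmulq_one map_rmulq.
  by rewrite scalemx1.
- by rewrite rmulq_tr -rmulqM lmul_conjq NL rmulqZ rmulq_one scalemx1.
- by rewrite det_rmulq NL.
Qed.

(** Removing one factor of norm [M] leaves [M] dividing the norm of the cofactor, but not the
    cofactor itself, so the splitting can be repeated. *)
Lemma quaternion_rotor_factor2 A :
  M ^+ 2 %| qnorm A -> ~ (forall i, M %| A i 0) ->
  exists L1 L2 A', [/\ linear_rotor M (lmulq L1) /\ linear_rotor M (lmulq L2),
    linear_rotor M (rmulq L1) /\ linear_rotor M (rmulq L2)
    & A = lmulq L1 *m (lmulq L2 *m A')].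
Proof.
move=> MMA nMA.
have M0 : M != 0 by rewrite monic_neq0.
have [|L1 [A1 [l1 r1 N1 AE]]] := quaternion_rotor_factor _ nMA.
  by apply: dvdp_trans MMA; rewrite expr2 dvdp_mulr.
have [||L2 [A2 [l2 r2 _ A1E]]] := quaternion_rotor_factor (A := A1).
- by move: MMA; rewrite AE qnormM N1 expr2 dvdp_mul2l.
- move=> MA1; apply: nMA => i; rewrite AE; apply: dvdp_mulmxr => k j.
  by rewrite ord1.
by exists L1, L2, A2; rewrite -A1E.
Qed.

Lemma spin_factor_step A B (P := lmulq A *m rmulq B) :
  M ^+ 2 %| qnorm A * qnorm B -> ~ (forall i j, M %| P i j) ->
  exists K1 K2 A' B', [/\ linear_rotor M K1, linear_rotor M K2 &
    P = K1 *m K2 *m (lmulq A' *m rmulq B')].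
Proof.
move=> MM nP.
have nMA : ~ forall i, M %| A i 0.
  by move=> MA; apply: nP; apply: dvdp_mulmxl; apply: dvdp_lmulq.
have nMB : ~ forall i, M %| B i 0.
  by move=> MB; apply: nP; apply: dvdp_mulmxr; apply: dvdp_rmulq.
(* If [M] is coprime to N(A), then M^2 divides N(B): both rotors come from [B] and commute past
   [lmulq A]. *)
have [MA|/(irreducible_coprimep Mirr) cA] := boolP (M %| qnorm A); last first.
  have [|L1 [L2 [B' [_ [r1 r2] BE]]]] := quaternion_rotor_factor2 _ nMB.
    by move: MM; rewrite mulrC Gauss_dvdpl // coprimep_expl.
  exists (rmulq L1), (rmulq L2), A, B'; split=> //.
  rewrite /P BE !rmulqM mulmxA lrmulqC -mulmxA.
  by rewrite (mulmxA (lmulq A)) lrmulqC !mulmxA.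
have [MB|/(irreducible_coprimep Mirr) cB] := boolP (M %| qnorm B); last first.
  have [|L1 [L2 [A' [[l1 l2] _ AE]]]] := quaternion_rotor_factor2 _ nMA.
    by move: MM; rewrite Gauss_dvdpl // coprimep_expl.
  exists (lmulq L1), (lmulq L2), A', B; split=> //.
  by rewrite /P AE !lmulqM !mulmxA.
(* [M] divides both norms: one rotor comes from each side. *)
have [L1 [A' [l1 _ _ AE]]] := quaternion_rotor_factor MA nMA.
have [L2 [B' [_ r2 _ BE]]] := quaternion_rotor_factor MB nMB.
exists (lmulq L1), (rmulq L2), A', B'; split=> //.
rewrite /P AE BE lmulqM rmulqM -!mulmxA; congr (_ *m _).
by rewrite !mulmxA lrmulqC.
Qed.

End LinearFactors.

(** * Quadratic curves and the induction on the degree *)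

Definition curve_of (R : realType) (p : 'M[{poly R}]_4) (q : {poly R}) :
    R -> 'M[R]_4 :=
  fun t => \matrix_(i, j) ((p i j).[t] / q.[t]).

Lemma curve_ofE (R : realType) (p : 'M[{poly R}]_4) q t :
  curve_of p q t = q.[t]^-1 *: map_mx (horner_eval t) p.
Proof. by apply/matrixP => i j; rewrite !mxE mulrC. Qed.

Lemma rotor_mulE (R : realType) (M : {poly R}) K1 K2 :
  linear_rotor M K1 -> linear_rotor M K2 ->
  forall i j,
    (size ((K1 *m K2) i j) <= 3)%N /\ ((K1 *m K2) i j)`_2 = (i == j)%:R.
Proof.
move=> [[H1 ->] _ _] [[H2 ->] _ _] i j.
rewrite mulmxDl !mulmxDr -map_mxM -scalar_mxM mul_scalar_mx mul_mx_scalar.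
move: (H1 *m H2) => H; rewrite !mxE -expr2.
split.
  apply/leq_sizeP => -[|[|[|k]]] // _.
  by rewrite !(coefD, coefMn, coefXn, coefXM, coefC) /= mul0rn !addr0.
by rewrite !(coefD, coefMn, coefXn, coefXM, coefC) /= !addr0.
Qed.

(** Each rotor is orthogonal up to the scalar [M], so the product divided by [M] is orthogonal of
    determinant M^4 / M^4 = 1. *)
Lemma rotor_mul_curve (R : realType) (M : {poly R}) K1 K2 :
  M \is monic -> size M = 3%N -> irreducible_poly M ->
  (forall x, ~~ root M x) -> ~ (forall i j, M %| (K1 *m K2) i j) ->
  linear_rotor M K1 -> linear_rotor M K2 ->
  Rat4 (curve_of (K1 *m K2) M) /\ rational_degree (curve_of (K1 *m K2) M) 2.
Proof.
move=> Mmon sM Mirr M0 nM l1 l2; set G := K1 *m K2.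
have rep : represents G M (curve_of G M).
  split=> //; last by move=> i j; rewrite sM; have [] := rotor_mulE l1 l2 i j.
  apply: (irreducible_coprimep Mirr); apply/negP => /dvdp_biggcd MG.
  by apply: nM => i j; apply: (MG (i, j)).
split; last by exists G, M; rewrite sM.
split; last first.
  apply/(represents_cvg1P rep) => i j.
  by rewrite sM (monicP Mmon) mulr1; have [] := rotor_mulE l1 l2 i j.
split; last by exists G, M.
move: l1 l2 => [_ KK1 d1] [_ KK2 d2] t.
have Mt0 : M.[t] != 0 by apply: M0.
have GG : G^T *m G = (M ^+ 2)%:M.
  rewrite trmx_mul mulmxA -(mulmxA K2^T) KK1 mul_mx_scalar -scalemxAl KK2.
  by rewrite scale_scalar_mx -expr2.
rewrite curve_ofE /SO4 /=; split.
  apply: mulmx1C; rewrite linearZ /= [X in X *m _]linearZ /= -scalemxAl.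
  rewrite map_trmx -map_mxM GG.
  rewrite map_scalar_mx !scale_scalar_mx /= /horner_eval horner_exp.
  by congr _%:M; field.
rewrite detZ det_map_mx det_mulmx d1 d2 /= /horner_eval hornerM horner_exp.
by field.
Qed.

(** Coprimality stated through common divisors, a form that passes at once to the cofactor left by a
    quadratic factor. *)
Definition matrix_primitive (R : realType) (p : 'M[{poly R}]_4)
    (q : {poly R}) :=
  forall r, r %| q -> (forall i j, r %| p i j) -> size r = 1%N.

Lemma spin_curve_factor (R : realType) d (q : {poly R}) (A B : 'cV[{poly R}]_4)
    (P : 'M[{poly R}]_4) :
  P = lmulq A *m rmulq B ->
  size q = (2 * d).+1 -> (forall t, ~~ root q t) ->
  qnorm A * qnorm B = q ^+ 2 ->
  (forall i j, (size (P i j) <= size q)%N) -> identity_at_infinity P q ->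
  matrix_primitive P q ->
  exists g : nat -> R -> 'M[R]_4,
    (forall k, (k < d)%N -> Rat4 (g k) /\ rational_degree (g k) 2) /\
    forall t, map_mx (horner_eval t) P = q.[t] *: \prod_(k < d) g k t.
Proof.
elim: d q A B P => [|d IH] q A B P PAB sq q0 NAB sP topP primP.
  (* Here [q] and [P] are constant, and [topP] says that [P] is [q] times the identity. *)
  exists (fun _ _ => 1); split=> // t; rewrite big_ord0.
  apply/matrixP => i j.
  have sPij : (size (P i j) <= 1)%N by have := sP i j; rewrite sq.
  have := topP i j; rewrite /lead_coef sq /= => Pij.
  rewrite !mxE [P i j]size1_polyC // [q]size1_polyC ?sq //=.
  rewrite /horner_eval !hornerC.
  by rewrite Pij mulrC.
have [|M [Mmon sM Mirr /dvdpP[q' qE]]] := monic_quadratic_factor _ q0.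
  by rewrite sq mulnS.
have Mn0 : M != 0 by rewrite monic_neq0.
have nMP : ~ forall i j, M %| P i j.
  by move=> MP; have := primP M; rewrite sM qE dvdp_mull // => /(_ isT MP).
have [||K1 [K2 [A' [B' [l1 l2]]]]] :=
  spin_factor_step (A := A) (B := B) Mmon sM Mirr.
- by rewrite NAB qE exprMn dvdp_mull.
- by rewrite -PAB.
set G := K1 *m K2; rewrite -PAB.
have [P' P'AB] : exists P', P' = lmulq A' *m rmulq B' by eexists.
rewrite -P'AB => PE.
have sq' : size q' = (2 * d).+1.
  have q'0 : q' != 0.
    by apply: contraNneq (q0 0) => q'0; rewrite qE q'0 mul0r root0.
  by move: sq; rewrite qE size_Mmonic // sM mulnS addnC /= => -[].
have q'_root t : ~~ root q' t.
  by apply: contraNN (q0 t); rewrite qE rootM => ->.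
have M_root t : ~~ root M t.
  by apply: contraNN (q0 t); rewrite qE rootM orbC => ->.
have GtG : G^T *m G = (M ^+ 2)%:M.
  case: l1 l2 => [_ KK1 _] [_ KK2 _].
  rewrite trmx_mul mulmxA -(mulmxA K2^T) KK1 mul_mx_scalar -scalemxAl KK2.
  by rewrite scale_scalar_mx -expr2.
have Gtop := rotor_mulE l1 l2.
(* From M^2 P' = G^T P: the degree of P' is at most 2 + deg q - 4 = deg q'. *)
have sP' i j : (size (P' i j) <= size q')%N.
  have P'E : M ^+ 2 * P' i j = (G^T *m P) i j.
    by rewrite PE mulmxA GtG mul_scalar_mx mxE.
  have [->|P'0] := eqVneq (P' i j) 0; first by rewrite size_poly0.
  have : (size (M ^+ 2 * P' i j)%R <= 3 + (2 * d).+2)%N.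
    rewrite P'E mxE; apply: (leq_trans (size_sum _ _ _)).
    apply/bigmax_leqP => k _.
    rewrite (leq_trans (size_polyMleq _ _)) // mxE.
    have [sG _] := Gtop k i; have := sP k j; rewrite sq mulnS => sPk.
    by rewrite -subn1 leq_subLR (leq_trans (leq_add sG sPk)).
  rewrite size_monicM ?monic_exp // sq'.
  have -> : size (M ^+ 2)%R = 5%N by rewrite expr2 size_Mmonic // sM.
  by rewrite addSn /= !addnS !addSn !ltnS add0n.
(* The X^2 coefficient of [G] is the identity matrix, so [P] and [P'] have the same top
   coefficients. *)
have topP' : identity_at_infinity P' q'.
  move=> i j; rewrite sq' /=.
  have lq : lead_coef q = lead_coef q'.
    by rewrite qE lead_coef_Mmonic.
  have := topP i j; rewrite lq => <-; rewrite sq PE mxE mulnS /=.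
  rewrite (bigD1 i) //= coefD coef_sum big1 => [|k ki].
    rewrite addr0 coefM_top //; [|by case: (Gtop i i)|by rewrite -sq'].
    by have [_ ->] := Gtop i i; rewrite eqxx mul1r.
  rewrite coefM_top //; [|by case: (Gtop i k)|by rewrite -sq'].
  by have [_ ->] := Gtop i k; rewrite eq_sym (negPf ki) mul0r.
have primP' : matrix_primitive P' q'.
  move=> r rq rP; apply: primP; first by rewrite qE dvdp_mulr.
  by rewrite PE; apply: dvdp_mulmxr.
(* Otherwise the numerators of the quadratic factor would not be coprime to
   [M], and [M] would divide [P] as well. *)
have nMG : ~ forall i j, M %| G i j.
  by move=> MG; apply: nMP; rewrite PE; apply: dvdp_mulmxl.
(* Computing P^T P from [A], [B] and from [G], [A'], [B'] gives q^2 = M^2 N(A') N(B'); cancel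
   M^2. *)
have NAB' : qnorm A' * qnorm B' = q' ^+ 2.
  have := lrmulq_tr A B; rewrite -PAB PE trmx_mul mulmxA -(mulmxA P'^T) GtG.
  rewrite mul_mx_scalar -scalemxAl P'AB lrmulq_tr NAB scale_scalar_mx.
  move/(congr1 (fun X : 'M_4 => X o0 o0)).
  rewrite !mxE /= !mulr1n qE exprMn mulrC.
  by apply: mulIf; rewrite expf_neq0.
have [g [gP gE]] := IH q' A' B' P' P'AB sq' q'_root NAB' sP' topP' primP'.
exists (fun k => if k is k'.+1 then g k' else curve_of G M); split.
  by move=> [_|k hk]; [exact: rotor_mul_curve|exact: gP].
move=> t; rewrite big_ord_recl /= PE map_mxM gE curve_ofE qE hornerM.
rewrite -mulmxE -scalemxAl -scalemxAr !scalerA.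
by rewrite mulfK //; apply: M_root.
Qed.

(** * From the given curve to its quaternion polynomials *)

Theorem theorem3p1 (R : realType) (d : nat) (hd : (1 <= d)%N)
    (gamma : R -> 'M[R]_4) (hgamma : Rat4 gamma)
    (hdeg : rational_degree gamma (2 * d)) :
  exists gammas : 'I_d -> R -> 'M[R]_4,
    (forall k, Rat4 (gammas k) /\ rational_degree (gammas k) 2) /\
    (forall t, gamma t = \prod_(k < d) gammas k t).
Proof.
case: hdeg => P [q [rep sq1]]; have [[SOg _] lim] := hgamma.
have topP := (represents_cvg1P rep).1 lim.
case: (rep) => q0 cop sP gE.
have sq : size q = (2 * d).+1.
  rewrite -sq1 prednK // size_poly_gt0.
  by apply: contraNneq (q0 0) => ->; rewrite root0.
have PgE t : map_mx (horner_eval t) P = q.[t] *: gamma t.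
  by apply/matrixP => i j; rewrite gE !mxE mulrC divfK //; apply: q0.
(* A polynomial identity, checked at every real t: [euler_mx] is linear, so at t it is q(t) times
   the Euler matrix of [gamma t]. *)
have minors i j k l :
    euler_mx P i j * euler_mx P k l = euler_mx P i l * euler_mx P k j.
  apply/eqP; rewrite -subr_eq0; apply/eqP; apply: horner_eq0_poly0 => t.
  have evalE a b : (euler_mx P a b).[t] = q.[t] * euler_mx (gamma t) a b.
    have := map_euler_mx (horner_eval t) P; rewrite PgE => /matrixP/(_ a b).
    rewrite [LHS]mxE => /(etrans (erefl (euler_mx P a b).[t])) ->; move: a b.
    by apply: ord4P; apply: ord4P; rewrite !mx4E /= !mxE; ring.
  have [gg dg] := SOg t.
  rewrite hornerD hornerN !hornerM !evalE.
  by rewrite mulrACA (euler_mx_minors gg dg) mulrACA subrr.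
have [A [B PAB]] := spin_factor minors.
(* At every t, P^T P is q(t)^2 times the identity because [gamma t] is orthogonal. *)
have NAB : qnorm A * qnorm B = q ^+ 2.
  apply/eqP; rewrite -subr_eq0; apply/eqP; apply: horner_eq0_poly0 => t.
  have := congr1 (map_mx (horner_eval t)) (lrmulq_tr A B).
  rewrite -PAB map_mxM -map_trmx PgE map_scalar_mx.
  have [/mulmx1C gg _] := SOg t.
  rewrite [X in X *m _]linearZ /= -scalemxAl -scalemxAr gg scalerA scalemx1.
  move/(congr1 (fun X : 'M_4 => X o0 o0)); rewrite !mxE /= !mulr1n /horner_eval.
  by rewrite hornerD hornerN horner_exp expr2 => ->; rewrite subrr.
have primP : matrix_primitive P q.
  move=> r rq rP; apply/eqP.
  have /coprimepP := cop; rewrite size_poly_eq1; apply => //.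
  by apply/dvdp_biggcd => ij.
have [g [gP gE']] := spin_curve_factor PAB sq q0 NAB sP topP primP.
exists (fun k => g k); split=> [k|t]; first exact: gP.
apply: (scalerI (q0 t)); rewrite -PgE; exact: gE'.
Qed.
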